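(* Let $k$ be an algebraically closed field of characteristic zero, let $\mathcal{A}$ be an integral domain containing $k$ which is a local ring, and let $\phi$ be a $k$-algebra endomorphism of $\mathcal{A}$ which is locally finite over $k$. Assume that at least one of the following holds: (a) $\mathcal{A}$ is finitely generated as a $k$-algebra; or (b) $\phi$ is injective and the quotient field $Q(\mathcal{A})$ of $\mathcal{A}$ is a finitely generated field extension of $k$. Then there exist integers $1\le i<j$ such that $\phi^i=\phi^j$. In particular, $\operatorname{Im}(1-\phi)$ is a Mathieu-Zhao space of $\mathcal{A}$.
   Context: Here $1$ denotes the identity map of $\mathcal{A}$ and $\phi^i$ denotes the $i$-fold composition. A $k$-linear map $T:\mathcal{A}\to\mathcal{A}$ is locally finite if for each $a\in\mathcal{A}$ the $k$-subspace spanned by the elements $T^m(a)$ ($m\ge 0$) is finite dimensional over $k$. For a $k$-subspace $M$ of a commutative $k$-algebra $\mathcal{A}$, the radical $\mathfrak{r}(M)$ is the set of $a\in\mathcal{A}$ such that $a^m\in M$ for all sufficiently large $m$. The subspace $M$ is a Mathieu-Zhao space (MZ-space) of $\mathcal{A}$ if for every $a\in\mathfrak{r}(M)$ and every $b\in\mathcal{A}$ there exists $N_b\ge 1$ such that $ba^m\in M$ for all $m\ge N_b$. *)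

(* Defs.v *)
From HB Require Import structures.
From mathcomp Require Import all_boot all_algebra.
From mathcomp Require Import boolp classical_sets.

Set Implicit Arguments.
Unset Strict Implicit.
Unset Printing Implicit Defensive.

Import GRing.Theory.
Local Open Scope ring_scope.
Local Open Scope classical_set_scope.

(* Subsets are Prop-valued [set T]; [mem M] turns one into the collective
   predicate expected by the closure conditions of ssralg and ring_quotient. *)

#[short(type="idomainAlgType")]
HB.structure Definition IdomainAlgebra (R : nzRingType) :=
  {A of GRing.ComUnitAlgebra R A & GRing.IntegralDomain A}.

Section LinearSpan.
Variables (k : fieldType) (V : lmodType k).

Definition lin_span (S : set V) : set V :=
  smallest (fun M : set V => GRing.submod_closed (mem M)) S.

Definition finite_dim (W : set V) : Prop :=
  exists s : seq V, W = lin_span [set` s].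

Definition locally_finite (T : V -> V) : Prop :=
  forall a : V, finite_dim (lin_span (range (fun m : nat => iter m T a))).

End LinearSpan.

Section CommutativeAlgebra.
Variables (k : fieldType) (A : comAlgType k).

Definition subalg_gen (S : set A) : set A :=
  smallest (fun B : set A => GRing.subalg_closed (mem B)) S.

Definition fin_gen_algebra : Prop :=
  exists s : seq A, subalg_gen [set` s] = [set: A].

Definition radical (M : set A) : set A :=
  [set a | exists N : nat, forall m : nat, (N <= m)%N -> M (a ^+ m)].

Definition MZ_space (M : set A) : Prop :=
  GRing.submod_closed (mem M) /\
  forall a : A, radical M a -> forall b : A,
    exists Nb : nat, (1 <= Nb)%N /\
      forall m : nat, (Nb <= m)%N -> M (b * a ^+ m).

End CommutativeAlgebra.

Section LocalRing.
Variable A : comNzRingType.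

(* [idealr_closed] characterises proper ideals: it includes 1 \notin I. *)
Definition maximal_ideal (m : set A) : Prop :=
  idealr_closed (mem m) /\
  forall I : set A, idealr_closed (mem I) -> m `<=` I -> I = m.

(* No Noetherian condition is imposed. *)
Definition local_ring : Prop := exists! m : set A, maximal_ideal m.

End LocalRing.

Section FieldExtension.
Variables (k L : fieldType) (iota : {rmorphism k -> L}).

(* In a field, [divring_closed] subsets are exactly the subfields. *)
Definition subfield_gen (S : set L) : set L :=
  smallest (fun K : set L => GRing.divring_closed (mem K)) S.

Definition fin_gen_field_ext : Prop :=
  exists s : seq L, subfield_gen (range iota `|` [set` s]) = [set: L].

End FieldExtension.

Definition fraction_emb (k : fieldType) (A : idomainAlgType k) :
    {rmorphism k -> {fraction A}} :=
  (@tofrac A \o in_alg A : {rmorphism k -> {fraction A}}).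

(* Main.v *)
Require Import Defs.
From HB Require Import structures.
From mathcomp Require Import all_boot all_algebra.
From mathcomp Require Import boolp classical_sets.

Set Implicit Arguments.
Unset Strict Implicit.
Unset Printing Implicit Defensive.

Import GRing.Theory.
Local Open Scope ring_scope.
Local Open Scope classical_set_scope.

(** Everything rests on one observation: a locally finite endomorphism cannot
    move a unit along a line. Suppose that d is a unit of A and that the images
    of d under infinitely many iterates of phi have the form x - mu y, with
    pairwise distinct mu in k. The inverses 1 / (x - mu y) then lie in one
    finite-dimensional space, hence satisfy a linear relation; by partial
    fractions it is a nonzero polynomial relation on x / y, and k is
    algebraically closed, so that x and y are proportional over k
    ([unit_orbit_collinear]).

    Locality supplies the units: for every v, one of 1 - v and 1 - 2v is
    invertible ([local_affine_unit]). Taking v to be an eigenvector, with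
    eigenvalue l different from 0, the iterates of 1 - c v run along the points
    1 - c l^m v, and proportionality forces l = 1; so l must have been a root of
    unity ([eigenvalue_root_of_unity]). Taking psi v = v + w with psi w = w for
    an iterate psi of phi, the iterates of 1 - c v run along the points
    (1 - c v) - c m w, distinct because the characteristic is zero, and
    proportionality forces w = 0 ([unipotent_trivial]). Thus the nonzero
    eigenvalues of phi are roots of unity and phi is semisimple on their
    generalized eigenspaces: every single element is eventually periodic
    ([eventually_periodic]).

    Finitely many elements have a common pre-period e and period N. If A is a
    finitely generated algebra, this applied to generators gives
    phi^(e+N) = phi^e. If phi is injective, then e = 0 may be taken; applied to
    numerators and denominators of generators of the fraction field, it shows
    that the fractions of phi^N-fixed elements, which form a subfield, are all of
    the fraction field, and so phi^N = 1 ([fixed_fractions_id]).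

    Finally, if phi^(e+N) = phi^e, then since (1 + X + ... + X^(N-1)) X^e takes
    the nonzero value N at X = 1, the image of 1 - phi is the kernel of
    phi^e + ... + phi^(e+N-1) ([image_1BP]). If all large powers of a lie there,
    then all large power sums of phi^e a, ..., phi^(e+N-1) a vanish, so that these
    elements are zero ([power_sums_eq0]), and b a^m is in the kernel for every
    m >= 1 ([image_1B_MZ]). *)

(** * Iterates of an algebra endomorphism *)

Section IterateMorphism.
Variables (k : nzRingType) (A : algType k) (phi : {lrmorphism A -> A}) (n : nat).

Lemma iter_linear : linear (iter n phi).
Proof. by move=> c x y; elim: n => //= m ->; rewrite linearP. Qed.

Lemma iter_monoid_morphism : monoid_morphism (iter n phi).
Proof.
split=> [|x y]; first by elim: n => //= m ->; rewrite rmorph1.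
by elim: n => //= m ->; rewrite rmorphM.
Qed.

HB.instance Definition _ := GRing.isLinear.Build k A A *:%R (iter n phi) iter_linear.
HB.instance Definition _ := GRing.isMonoidMorphism.Build A A (iter n phi) iter_monoid_morphism.

Lemma iterZ (c : k) (x : A) : iter n phi (c *: x) = c *: iter n phi x.
Proof. exact: linearZ. Qed.

End IterateMorphism.

(** * Linear relations in finite-dimensional orbits *)

Section FiniteDimension.
Variables (k : fieldType) (V : lmodType k).

Lemma lin_span_seqP (s : seq V) (v : V) :
  lin_span [set` s] v -> exists c : 'I_(size s) -> k, v = \sum_i c i *: s`_i.
Proof.
move=> /(_ [set v | exists c : 'I_(size s) -> k, v = \sum_i c i *: s`_i]) /=; apply.
split.
  split; first by rewrite inE /=; exists (fun=> 0); rewrite big1 // => i _; rewrite scale0r.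
  move=> a u w; rewrite !inE /= => -[c ->] [d ->].
  exists (fun i => a * c i + d i).
  rewrite scaler_sumr -big_split /=; apply: eq_bigr => i _.
  by rewrite scalerDl scalerA.
move=> u /= us; have lt_us : (index u s < size s)%N by rewrite index_mem.
exists (fun i => (i == Ordinal lt_us)%:R).
rewrite (bigD1 (Ordinal lt_us)) //= eqxx scale1r nth_index // big1 ?addr0 // => i /negPf ->.
by rewrite scale0r.
Qed.

(** One vector more than the spanning sequence has suffices: the matrix of
    coefficients then has more rows than columns, hence a left kernel. *)
Lemma finite_dim_relation (W : set V) (f : nat -> V) :
    finite_dim W -> (forall m, W (f m)) ->
  exists n (c : 'I_n -> k), (exists i, c i != 0) /\ \sum_i c i *: f i = 0.
Proof.
move=> [s ->] Wf.
have [C fE] := choice (fun m => lin_span_seqP (Wf m)).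
pose M : 'M[k]_((size s).+1, size s) := \matrix_(i, j) C i j.
have : kermx M != 0.
  by rewrite kermx_eq0 /row_free neq_ltn ltnS rank_leq_col.
case/rowV0Pn => v /sub_kermxP vM0 v_neq0.
exists (size s).+1, (v 0); split.
  by case/rV0Pn: v_neq0 => i vi; exists i.
under eq_bigr => i _ do rewrite fE scaler_sumr.
rewrite exchange_big /= big1 // => j _.
under eq_bigr => i _ do rewrite scalerA.
rewrite -scaler_suml; have /rowP/(_ j) := vM0; rewrite !mxE => vMj.
rewrite [X in X *: _](_ : _ = 0) ?scale0r // -[RHS]vMj.
by apply: eq_bigr => i _; rewrite mxE.
Qed.

(** The exponents run through an arbitrary function f, not just the identity,
    so that the relation can be taken along the iterates of a power of T. *)
Lemma locally_finite_relation (T : V -> V) (f : nat -> nat) (a : V) :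
    locally_finite T ->
  exists n (c : 'I_n -> k),
    (exists i, c i != 0) /\ \sum_i c i *: iter (f i) T a = 0.
Proof.
move=> Tlf; apply: (finite_dim_relation (Tlf a) (f := fun m => iter (f m) T a)).
by move=> m; apply: sub_gen_smallest; exists (f m).
Qed.

End FiniteDimension.

(** * Units of a local ring *)

Section LocalUnits.
Variable R : comUnitRingType.

Lemma ideal_sub_maximal (J : set R) :
  idealr_closed (mem J) -> exists2 M, maximal_ideal M & J `<=` M.
Proof.
move=> [J0 J1 JD].
(* Ordering the sets X with J `|` X an ideal, rather than the ideals above J,
   makes the union of the empty chain admissible. *)
pose P := [set X : set R | idealr_closed (mem (J `|` X))].
have [F FP Ftot|X [PX Xmax]] := @Zorn_bigcup _ P.
  split.
  - by rewrite inE; left; rewrite inE in J0.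
  - apply/negP; rewrite inE => -[J1'|[X /FP [_ /negP X1 _] X1']].
      by case/negP: J1; rewrite inE.
    by apply: X1; rewrite inE; right.
  - move=> a u v; rewrite !inE.
    have step X Y : F X -> F Y -> (J `|` X) u -> (J `|` Y) v -> (J `|` \bigcup_(X in F) X) (a * u + v).
      move=> FX FY Xu Yv.
      have [Z [FZ Zu Zv]] : exists Z, [/\ F Z, (J `|` Z) u & (J `|` Z) v].
        case: (Ftot _ _ FX FY) => sub; [exists Y|exists X]; split=> //.
          by case: Xu => ?; [left|right; apply: sub].
        by case: Yv => ?; [left|right; apply: sub].
      have [_ _ /(_ a u v)] := FP _ FZ; rewrite !inE => /(_ Zu Zv)[]; first by left.
      by right; exists Z.
    have JJ : J u -> J v -> J (a * u + v) by move: (JD a u v); rewrite !inE.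
    move=> [Ju|[X FX Xu]] [Jv|[Y FY Yv]].
    + by left; apply: JJ.
    + by apply: (step Y Y) => //; [left|right].
    + by apply: (step X X) => //; [right|left].
    + by apply: (step X Y) => //; right.
exists (J `|` X); last by move=> x; left.
split=> // I I_ideal JXI; have JI : J `|` I = I by apply/setUidPr => x Jx; apply: JXI; left.
have [XI|neXI] := EM (X = I); first by rewrite XI.
case: (Xmax I); last by rewrite /P /= JI.
by split=> [x Xx|IX]; [apply: JXI; right | apply: neXI; apply/seteqP; split=> // x Xx; apply: JXI; right].
Qed.

(** A nonunit generates a proper ideal, so it lies in the unique maximal ideal;
    two nonunits with an invertible sum would put 1 there. *)
Lemma local_ring_unitD (x y : R) : local_ring R ->
  x + y \is a GRing.unit -> x \is a GRing.unit \/ y \is a GRing.unit.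
Proof.
move=> [M [[[M0 M1 MD] _] Muniq]] xy_unit.
have nonunitM z : z \isn't a GRing.unit -> M z.
  move=> z_nu; have [|N Nmax] := @ideal_sub_maximal [set z * b | b in [set: R]].
    split; first by rewrite inE; exists 0; rewrite ?mulr0.
      apply/negP; rewrite inE => -[b _ zb1]; case/negP: z_nu.
      by apply/unitrPr; exists b.
    move=> a u v; rewrite !inE => -[b _ <-] [c _ <-].
    by exists (a * b + c) => //; rewrite mulrDr mulrCA.
  by rewrite (Muniq _ Nmax); apply; exists 1; rewrite ?mulr1.
have [|/nonunitM Mx] := boolP (x \is a GRing.unit); first by left.
have [|/nonunitM My] := boolP (y \is a GRing.unit); first by right.
case/negP: M1; rewrite -(mulVr xy_unit) mulrDr.
have My' : (x + y)^-1 * y \in mem M by rewrite -[_ * y]addr0 MD // inE.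
by rewrite MD // inE.
Qed.

End LocalUnits.

(** * Units whose orbit lies on a line *)

Section Collinearity.
Variables (k : closedFieldType) (A : idomainAlgType k).

(** The hypothesis is the relation on the fractions c_i / (x - mu_i y) with
    denominators cleared. It is homogeneous in x and y, so for nonzero y it says
    that x / y is a root of the polynomial P below; P is nonzero because only one
    of its summands survives at mu_i0, and all its roots are in k. *)
Lemma cofactor_sum_collinear n (c mu : 'I_n -> k) (i0 : 'I_n) (x y : A) :
    injective mu -> c i0 != 0 ->
    \sum_i c i *: \prod_(j | j != i) (x - mu j *: y) = 0 ->
  exists s t : k, (s, t) != (0, 0) /\ s *: x = t *: y.
Proof.
move=> mu_inj ci0 sum0.
have [->|y_neq0] := eqVneq y 0.
  exists 0, 1; rewrite scale0r scaler0; split=> //.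
  by rewrite xpair_eqE oner_eq0 andbF.
pose P : {poly k} := \sum_i c i *: \prod_(j | j != i) ('X - (mu j)%:P).
have P_neq0 : P != 0.
  apply/eqP => /(congr1 (fun p => p.[mu i0])); rewrite horner0 horner_sum.
  rewrite (bigD1 i0) //= [X in _ + X]big1 => [|i ne_ii0]; last first.
    by rewrite hornerZ horner_prod (bigD1 i0) 1?eq_sym //= hornerXsubC subrr mul0r mulr0.
  rewrite addr0 hornerZ horner_prod => /eqP; rewrite mulf_eq0 (negPf ci0) /=.
  apply/negP/prodf_neq0 => j ne_ji0; rewrite hornerXsubC subr_eq0.
  by rewrite (inj_eq mu_inj) eq_sym.
pose t : {fraction A} := tofrac x / tofrac y.
have yF : tofrac y != 0 by rewrite tofrac_eq0.
have xE : tofrac x = t * tofrac y by rewrite divfK.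
have : (map_poly (fraction_emb A) P).[t] * tofrac y ^+ n.-1 = 0.
  rewrite -[RHS](rmorph0 (@tofrac A)) -sum0 !rmorph_sum /= horner_sum mulr_suml.
  apply: eq_bigr => i _.
  rewrite map_polyZ hornerZ rmorph_prod horner_prod -mulrA -[c i *: _]mulr_algl.
  rewrite rmorphM rmorph_prod; congr (_ * _).
  have -> : n.-1 = #|[pred j : 'I_n | j != i]|.
    by rewrite cardC1 card_ord.
  rewrite -prodr_const -big_split /=; apply: eq_bigr => j _.
  rewrite map_polyXsubC hornerXsubC mulrBl -xE -[mu j *: y]mulr_algl.
  by rewrite rmorphB rmorphM.
move/eqP; rewrite mulf_eq0 expf_eq0 (negPf yF) andbF orbF.
have [r ->] := closed_field_poly_normal P.
rewrite map_polyZ hornerZ mulf_eq0 fmorph_eq0 lead_coef_eq0 (negPf P_neq0) /=.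
rewrite rmorph_prod horner_prod prodf_seq_eq0 => /hasP[z _ /=].
rewrite map_polyXsubC hornerXsubC subr_eq0 => /eqP tE.
exists 1, z; split; first by rewrite xpair_eqE oner_eq0.
apply/eqP; rewrite scale1r -tofrac_eq xE tE -mulr_algl rmorphM.
by [].
Qed.

Variable phi : {lrmorphism A -> A}.
Hypothesis phi_lf : locally_finite phi.

(** Linear dependence of the images of d^-1 becomes, after multiplication by the
    product of the images of d, the cofactor relation between x and y. *)
Lemma unit_orbit_collinear (f : nat -> nat) (mu : nat -> k) (d x y : A) :
    d \is a GRing.unit -> injective mu ->
    (forall m, iter (f m) phi d = x - mu m *: y) ->
  exists s t : k, (s, t) != (0, 0) /\ s *: x = t *: y.
Proof.
move=> d_unit mu_inj dE.
have [n [c [[i0 ci0] rel]]] := locally_finite_relation f d^-1 phi_lf.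
apply: (@cofactor_sum_collinear n c (fun i : 'I_n => mu i) i0) => //.
  by move=> i j /mu_inj/val_inj.
have /(etrans _) := congr1 ( *%R^~ (\prod_(i < n) iter (f i) phi d)) rel.
rewrite mul0r mulr_suml; apply.
apply: eq_bigr => i _; rewrite -scalerAl; congr (_ *: _).
rewrite [in RHS](bigD1 i) //= rmorphV // mulKr; last exact: rmorph_unit.
by apply: eq_bigr => j _; rewrite dE.
Qed.

End Collinearity.

(** * Eventual periodicity of every element *)

Section LocallyFiniteEndomorphism.
Variables (k : closedFieldType) (A : idomainAlgType k) (phi : {lrmorphism A -> A}).
Hypotheses (k_char0 : [pchar k] =i pred0) (A_local : local_ring A).
Hypothesis phi_lf : locally_finite phi.

(** Since 2 (1 - v) + (2 v - 1) = 1, one of c = 1 and c = 2 works. *)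
Lemma local_affine_unit (v : A) : exists2 c : k, c != 0 & 1 - c *: v \is a GRing.unit.
Proof.
have two_neq0 : 2%:R != 0 :> k by rewrite (pcharf0P k).1.
have [|u1|u2] := @local_ring_unitD A (2%:R * (1 - v)) (2%:R * v - 1) A_local.
- by rewrite mulrBr mulr1 addrA subrK mulr2n addrK unitr1.
- exists 1; first exact: oner_neq0.
  by rewrite scale1r; move: u1; rewrite unitrM => /andP[].
- by exists 2%:R; rewrite // -unitrN opprB scaler_nat -mulr_natl.
Qed.

(** If l is not a root of unity, its powers are distinct, and the orbit of the
    unit 1 - c w lies on the line of the points 1 - l^m (c w). Then w is a scalar
    multiple of 1, hence fixed by phi, so that l = 1 after all. *)
Lemma eigenvalue_root_of_unity (w : A) (l : k) :
  w != 0 -> l != 0 -> phi w = l *: w -> exists2 n, (0 < n)%N & l ^+ n = 1.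
Proof.
move=> w_neq0 l_neq0 phiw; apply: contrapT => no_root.
have pow_inj : injective (fun m => l ^+ m).
  move=> m n /= eq_mn; wlog lt_mn : m n eq_mn / (m < n)%N.
    by move=> H; case: (ltngtP m n) => // lt_mn; [|symmetry]; apply: H.
  case: no_root; exists (n - m)%N; first by rewrite subn_gt0.
  apply: (mulfI (expf_neq0 m l_neq0)).
  by rewrite -exprD subnKC ?mulr1 // ltnW.
have [c c_neq0 d_unit] := local_affine_unit w.
have iterw m : iter m phi w = l ^+ m *: w.
  by elim: m => [|m IHm] /=; rewrite ?scale1r // IHm linearZ /= phiw scalerA exprSr.
have [|s [t [st_neq0 st_eq]]] :=
    unit_orbit_collinear phi_lf (f := id) (x := 1) (y := c *: w) d_unit pow_inj.
  by move=> m; rewrite rmorphB rmorph1 /= iterZ iterw !scalerA mulrC.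
(* Compare the relation s 1 = t c w with its image under phi. *)
have /eqP := congr1 phi st_eq.
rewrite !linearZ /= rmorph1 phiw st_eq -subr_eq0.
have -> : t *: (c *: w) - t *: (c *: (l *: w)) = (t * c * (1 - l)) *: w.
  by rewrite !scalerA mulrBr mulr1 scalerBl.
rewrite scaler_eq0 (negPf w_neq0) orbF !mulf_eq0 (negPf c_neq0) orbF subr_eq0.
case/orP=> [/eqP t0|/eqP l1]; last by case: no_root; exists 1%N; rewrite // expr1 -l1.
move: st_neq0 st_eq; rewrite t0 scale0r => s_neq0 /eqP.
by rewrite scaler_eq0 oner_eq0 orbF => /eqP s0; rewrite s0 eqxx in s_neq0.
Qed.

(** The orbit of the unit 1 - c v under the M-th iterate lies on the line of the
    points (1 - c v) - m (c w). If s (1 - c v) = t c w, then applying that iterate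
    adds - s c w to the left-hand side only, so that s = 0 or w = 0. *)
Lemma unipotent_trivial (M : nat) (v w : A) :
  iter M phi w = w -> iter M phi v = v + w -> w = 0.
Proof.
move=> psiw psiv; apply/eqP/negPn/negP => w_neq0.
have [c c_neq0 d_unit] := local_affine_unit v.
have iterv m : iter (m * M) phi v = v + m%:R *: w.
  elim: m => [|m IHm]; first by rewrite scale0r addr0.
  rewrite mulSn iterD IHm linearD /= iterZ psiw psiv -addrA -[m.+1]add1n natrD.
  by rewrite scalerDl scale1r.
have nat_inj : injective (fun m : nat => m%:R : k).
  move=> m n /= /eqP; wlog le_mn : m n / (m <= n)%N.
    move=> H eq_mn; case: (leqP m n) => [|/ltnW] le_mn; [|symmetry]; apply: H => //.
    by rewrite eq_sym.
  by rewrite eq_sym -subr_eq0 -natrB // (pcharf0P k).1 // subn_eq0 => le_nm; apply/eqP; rewrite eqn_leq le_mn.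
have [|s [t [st_neq0 st_eq]]] :=
    unit_orbit_collinear phi_lf (f := fun m => (m * M)%N) (x := 1 - c *: v) (y := c *: w)
      d_unit nat_inj.
  move=> m; rewrite rmorphB rmorph1 /= iterZ iterv scalerDr opprD addrA.
  by rewrite !scalerA mulrC.
have := congr1 (iter M phi) st_eq.
rewrite !iterZ linearB /= iterZ rmorph1 psiw psiv -st_eq [c *: (v + w)]scalerDr.
rewrite opprD addrA [LHS]scalerBr => /eqP.
rewrite -subr_eq0 addrAC subrr add0r oppr_eq0.
rewrite !scaler_eq0 (negPf w_neq0) (negPf c_neq0) !orbF => /eqP s0.
move: st_neq0 st_eq; rewrite s0 scale0r xpair_eqE eqxx /= => t_neq0 /esym/eqP.
by rewrite !scaler_eq0 (negPf w_neq0) (negPf c_neq0) (negPf t_neq0).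
Qed.

(** The value at a of the endomorphism p(phi). *)
Definition poly_act (p : {poly k}) (a : A) : A := \sum_(i < size p) p`_i *: iter i phi a.

Lemma poly_act_widen n (p : {poly k}) a : (size p <= n)%N ->
  poly_act p a = \sum_(i < n) p`_i *: iter i phi a.
Proof.
move=> le_pn; rewrite /poly_act (big_ord_widen _ (fun i => p`_i *: iter i phi a) le_pn).
rewrite big_mkcond; apply: eq_bigr => i _; case: ltnP => // le_pi.
by rewrite nth_default // scale0r.
Qed.

Lemma poly_actZ (c : k) (p : {poly k}) a : poly_act (c *: p) a = c *: poly_act p a.
Proof.
rewrite (poly_act_widen a (size_scale_leq c p)) scaler_sumr.
by apply: eq_bigr => i _; rewrite coefZ scalerA.
Qed.

Lemma poly_actMXsubC (p : {poly k}) z a :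
  poly_act (p * ('X - z%:P)) a = poly_act p (phi a - z *: a).
Proof.
have le1 : (size (p * ('X - z%:P))%R <= (size p).+1)%N.
  by rewrite (leq_trans (size_polyMleq _ _)) // size_XsubC addn2.
rewrite (poly_act_widen _ le1).
under eq_bigr => i _ do rewrite mulrBr coefB coefMX coefMC scalerBl.
rewrite sumrB big_ord_recl /= scale0r add0r big_ord_recr /=.
rewrite [p`_(size p)]nth_default // mul0r scale0r addr0 -sumrB.
apply: eq_bigr => i _; rewrite linearB /= iterZ scalerBr scalerA -iterSr.
by [].
Qed.

(** Periodicity of phi a - z a makes u = (phi^N - 1) phi^e a an eigenvector for z.
    If z = 0, one more application of phi kills u. Otherwise z^n = 1 for some n > 0,
    and phi^(nN) - 1, which is a sum of iterates times phi^N - 1, sends phi^e a to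
    a multiple of u, hence to a vector fixed by phi^(nN); this is the unipotent
    situation. *)
Lemma eventually_periodic_of_subZ z a e N : (0 < N)%N ->
    iter (e + N) phi (phi a - z *: a) = iter e phi (phi a - z *: a) ->
  exists e' N', (0 < N')%N /\ iter (e' + N') phi a = iter e' phi a.
Proof.
move=> N_gt0 per; pose c := iter e phi a; pose u := iter N phi c - c.
have phiu : phi u = z *: u.
  move: per; rewrite !linearB /= !iterZ -!iterSr !iterS => per.
  rewrite -iterD addnC.
  rewrite -[phi (iter (e + N) phi a)](subrK (z *: iter (e + N) phi a)) per.
  by rewrite addrC !addrA addNr add0r addrC.
have [z0|z_neq0] := eqVneq z 0.
  exists e.+1, N; split=> //; apply/eqP.
  by rewrite -subr_eq0 addSn !iterS -linearB /= addnC iterD -/c -/u phiu z0 scale0r.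
have [u0|u_neq0] := eqVneq u 0.
  by exists e, N; split=> //; apply/eqP; rewrite -subr_eq0 addnC iterD -/c -/u u0.
have [n n_gt0 zn] := eigenvalue_root_of_unity u_neq0 z_neq0 phiu.
exists e, (n * N)%N; rewrite muln_gt0 n_gt0 N_gt0; split=> //.
have iteru m : iter m phi u = z ^+ m *: u.
  by elim: m => [|m IHm] /=; rewrite ?scale1r // IHm linearZ /= phiu scalerA exprSr.
apply/eqP; rewrite addnC iterD -/c -subr_eq0; apply/eqP.
apply: (@unipotent_trivial (n * N) c); last by rewrite addrC subrK.
have telescope : iter (n * N) phi c - c = \sum_(0 <= m < n) iter (m * N) phi u.
  rewrite -[X in _ - X]/(iter (0 * N) phi c).
  rewrite -(telescope_sumr (fun m => iter (m * N) phi c)) //.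
  apply: eq_bigr => m _; rewrite /u linearB /=.
  by rewrite mulSn addnC iterD.
rewrite telescope linear_sum; apply: eq_bigr => m _.
by rewrite /= iteru iterZ iteru (exprM z n N) zn expr1n scale1r.
Qed.

(** A polynomial p with p(phi) a = 0 splits over k, and its linear factors are
    peeled off one at a time. *)
Lemma eventually_periodic a :
  exists e N, (0 < N)%N /\ iter (e + N) phi a = iter e phi a.
Proof.
have [n [c [[i0 ci0] rel]]] := locally_finite_relation id a phi_lf.
pose p : {poly k} := \sum_(i < n) c i *: 'X^i.
have coefp (i : 'I_n) : p`_i = c i.
  rewrite coef_sum (bigD1 i) //= coefZ coefXn eqxx mulr1 big1 ?addr0 // => j ne_ji.
  by rewrite coefZ coefXn eq_sym (inj_eq val_inj) (negPf ne_ji) mulr0.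
have p_neq0 : p != 0 by apply: contraNneq ci0 => p0; rewrite -coefp p0 coef0.
have pa0 : poly_act p a = 0.
  rewrite (poly_act_widen a (n := n)) -?[RHS]rel; first by apply: eq_bigr => i _; rewrite coefp.
  rewrite (leq_trans (size_sum _ _ _)) //; apply/bigmax_leqP => i _.
  by rewrite (leq_trans (size_scale_leq _ _)) // size_polyXn.
have [rs pE] := closed_field_poly_normal p.
have {pa0 rel} : poly_act (\prod_(z <- rs) ('X - z%:P)) a = 0.
  move/eqP: pa0; rewrite pE poly_actZ scaler_eq0 lead_coef_eq0 (negPf p_neq0).
  by move/eqP.
elim: rs a {p p_neq0 coefp pE} => [|z rs IHrs] a.
  rewrite big_nil /poly_act size_poly1 big_ord1 coef1 scale1r => /= ->.
  by exists 0%N, 1%N; rewrite /= linear0.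
rewrite big_cons mulrC poly_actMXsubC => /IHrs[e [N [N_gt0]]].
exact: eventually_periodic_of_subZ.
Qed.

Lemma common_period (s : seq A) : exists e N,
  (0 < N)%N /\ forall a, a \in s -> iter (e + N) phi a = iter e phi a.
Proof.
have period_mul e N e' q a : iter (e + N) phi a = iter e phi a ->
    iter (e' + e + q * N) phi a = iter (e' + e) phi a.
  move=> per; elim: q => [|q IHq]; first by rewrite addn0.
  by rewrite mulSn [(N + _)%N]addnC addnACA iterD per -iterD addnAC.
elim: s => [|b s [e [N [N_gt0 per]]]]; first by exists 0%N, 1%N.
have [e' [N' [N'_gt0 per']]] := eventually_periodic b.
exists (e' + e)%N, (N' * N)%N; rewrite muln_gt0 N'_gt0; split=> // a.
rewrite inE => /predU1P[->|/per]; last exact: period_mul.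
by rewrite (addnC e' e) (mulnC N'); apply: period_mul.
Qed.

End LocallyFiniteEndomorphism.

(** * Power sums *)

(** Vanishing of the power sums from m0 on makes the sum of x_i^m0 P(x_i) vanish
    for every polynomial P. If P has as roots exactly the values other than x_i0,
    what remains is a positive multiple of x_i0^m0 P(x_i0). *)
Lemma power_sums_eq0 (R : idomainType) n (x : 'I_n -> R) m0 :
    [pchar R] =i pred0 -> (forall m, (m0 <= m)%N -> \sum_i x i ^+ m = 0) ->
  forall i, x i = 0.
Proof.
move=> R0 sum0 i0; apply/eqP/negPn/negP => xi0.
pose P : {poly R} := \prod_(y <- undup (codom x) | y != x i0) ('X - y%:P).
have root_P i : x i != x i0 -> P.[x i] = 0.
  move=> ne_ii0; apply/eqP; rewrite horner_prod prodf_seq_eq0.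
  apply/hasP; exists (x i); first by rewrite mem_undup codom_f.
  by rewrite ne_ii0 hornerXsubC subrr /=.
have Pi0 : P.[x i0] != 0.
  rewrite horner_prod prodf_seq_neq0; apply/allP => y _.
  by apply/implyP => ne_yi0; rewrite hornerXsubC subr_eq0 eq_sym.
have : \sum_i x i ^+ m0 * P.[x i] = 0.
  under eq_bigr => i _ do rewrite horner_coef mulr_sumr.
  rewrite exchange_big big1 //= => j _.
  under eq_bigr => i _ do rewrite mulrCA -exprD.
  by rewrite -mulr_sumr sum0 ?mulr0 // leq_addr.
rewrite (bigID (fun i => x i == x i0)) /= [X in _ + X]big1 => [|i ne_ii0]; last first.
  by rewrite root_P ?mulr0.
rewrite addr0 (eq_bigr (fun=> x i0 ^+ m0 * P.[x i0])) => [|i /eqP-> //].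
rewrite sumr_const -mulr_natr => /eqP.
rewrite !mulf_eq0 expf_eq0 (negPf xi0) (negPf Pi0) andbF /=.
apply/negP; rewrite (pcharf0P R).1 // -lt0n.
by apply/card_gt0P; exists i0; apply: eqxx.
Qed.

(** * The image of 1 - phi *)

Section EventuallyPeriodicImage.
Variables (k : fieldType) (A : idomainAlgType k) (phi : {lrmorphism A -> A}) (e N : nat).
Hypotheses (k_char0 : [pchar k] =i pred0) (N_gt0 : (0 < N)%N).
Hypothesis per : forall a, iter (e + N) phi a = iter e phi a.

Lemma image_1B_submod : GRing.submod_closed (mem (range (fun a : A => a - phi a))).
Proof.
split=> [|c u v]; first by rewrite inE; exists 0; rewrite // linear0 subr0.
rewrite !inE => -[a _ <-] [b _ <-]; exists (c *: a + b) => //.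
by rewrite linearP scalerBr opprD addrACA.
Qed.

(** One direction is a telescoping sum. For the other, if the sum vanishes then
    N a is the sum of the elements a - phi^(e+l) a, each of which is divisible by
    1 - phi because 1 - X divides 1 - X^m. *)
Lemma image_1BP a :
  range (fun a : A => a - phi a) a <-> \sum_(l < N) iter (e + l) phi a = 0.
Proof.
split=> [[b _ <-]|sum0].
  rewrite -(big_mkord xpredT (fun l => iter (e + l) phi (b - phi b))).
  rewrite (eq_bigr (fun l => - (iter (e + l.+1) phi b - iter (e + l) phi b))) => [|l _].
    by rewrite sumrN telescope_sumr // per addn0 subrr oppr0.
  by rewrite linearB /= -iterSr addnS opprB.
have N_neq0 : N%:R != 0 :> k by rewrite (pcharf0P k).1 // -lt0n.
exists (N%:R^-1 *: \sum_(l < N) \sum_(r < e + l) iter r phi a) => //.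
rewrite linearZ /= -scalerBr linear_sum -sumrB.
rewrite (eq_bigr (fun l : 'I_N => a - iter (e + l) phi a)) => [|l _].
  rewrite sumrB sum0 subr0 sumr_const card_ord -scaler_nat scalerA mulVf ?scale1r //.
rewrite linear_sum -sumrB -(big_mkord xpredT (fun r => iter r phi a - phi (iter r phi a))).
rewrite (eq_bigr (fun r => - (iter r.+1 phi a - iter r phi a))) => [|r _].
  by rewrite sumrN telescope_sumr // opprB.
by rewrite opprB.
Qed.

Lemma image_1B_MZ : MZ_space (range (fun a : A => a - phi a)).
Proof.
split=> [|a [m0 a_rad] b]; first exact: image_1B_submod.
have x0 : forall l : 'I_N, iter (e + l) phi a = 0.
  apply: (@power_sums_eq0 _ _ _ m0).
    by move=> p; rewrite (fmorph_pchar (in_alg A)) k_char0.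
  move=> m le_m0m; have /image_1BP := a_rad m le_m0m.
  by under eq_bigr => l _ do rewrite rmorphXn.
exists 1%N; split=> // m m_gt0; apply/image_1BP; rewrite big1 // => l _.
by rewrite rmorphM rmorphXn /= x0 expr0n -[m]prednK //= mulr0.
Qed.

End EventuallyPeriodicImage.

(** * Propagation from generators *)

Lemma fin_gen_algebra_ext (k : fieldType) (A : comAlgType k) (f g : {lrmorphism A -> A})
    (s : seq A) :
  subalg_gen [set` s] = [set: A] -> (forall a, a \in s -> f a = g a) -> f =1 g.
Proof.
move=> sT fg a; have : subalg_gen [set` s] a by rewrite sT.
move/(_ [set a | f a = g a]) => /=; apply; split=> [|b /fg //].
split; first by rewrite inE /= !rmorph1.
- by move=> c u v; rewrite !inE /= !linearP /= => -> ->.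
- by move=> u v; rewrite !inE /= !rmorphM /= => -> ->.
Qed.

Lemma fractionP (R : idomainType) (x : {fraction R}) :
  exists a b : R, b != 0 /\ x = tofrac a / tofrac b.
Proof.
elim/quotW: x => r; exists \n_r, \d_r; split; first exact: denom_ratioP.
have d_neq0 : tofrac \d_r != 0 by rewrite tofrac_eq0 denom_ratioP.
apply: (canRL (mulfK d_neq0)).
unlock FracField.tofrac; rewrite -[LHS]FracField.pi_mul; apply/eqmodP.
rewrite /= FracField.equivfE /FracField.mulf !numden_Ratio ?mulf_neq0 ?oner_eq0 ?denom_ratioP //.
by rewrite !mulr1 mulrC.
Qed.

Section FractionFieldPeriod.
Variables (k : fieldType) (A : idomainAlgType k) (psi : {lrmorphism A -> A}).

(** Using fractions of fixed elements instead of the fixed fractions avoids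
    extending psi to the fraction field. *)
Definition fixed_fraction (q : {fraction A}) : Prop :=
  exists a b : A, [/\ b != 0, psi a = a, psi b = b & q = tofrac a / tofrac b].

Lemma fixed_fraction_subfield : GRing.divring_closed (mem [set q | fixed_fraction q]).
Proof.
split=> [|p q|p q]; rewrite !inE /=.
- by exists 1, 1; rewrite oner_neq0 !rmorph1 divr1.
- move=> [a [b [b0 fa fb ->]]] [c [d [d0 fc fd ->]]].
  exists (a * d - c * b), (b * d); rewrite mulf_neq0 // rmorphB !rmorphM /= fa fb fc fd.
  by split=> //; rewrite -mulNr addf_div ?tofrac_eq0 // !rmorphB !rmorphM mulNr.
- move=> [a [b [b0 fa fb ->]]] [c [d [d0 fc fd ->]]].
  have [->|c0] := eqVneq c 0.
    by exists 0, 1; rewrite oner_neq0 !rmorph0 !rmorph1 !mul0r invr0 mulr0.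
  exists (a * d), (b * c); rewrite mulf_neq0 // !rmorphM /= fa fb fc fd.
  by split=> //; rewrite invf_div mulf_div.
Qed.

(** If a = b / c with b and c fixed, then psi a and a both have product b with c. *)
Lemma fixed_fractions_id (s : seq {fraction A}) :
    subfield_gen (range (fraction_emb A) `|` [set` s]) = [set: {fraction A}] ->
    (forall q, q \in s -> fixed_fraction q) ->
  forall a, psi a = a.
Proof.
move=> sT fix_s a.
have : subfield_gen (range (fraction_emb A) `|` [set` s]) (tofrac a) by rewrite sT.
move/(_ [set q | fixed_fraction q]) => /= [|b [c [c0 fb fc aE]]].
  split; first exact: fixed_fraction_subfield.
  move=> q [[c _ <-]|/fix_s //]; exists c%:A, 1.
  by rewrite oner_neq0 rmorph1 divr1 linearZ /= rmorph1.
have ac : a * c = b.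
  by apply/eqP; rewrite -tofrac_eq rmorphM /= aE divfK ?tofrac_eq0.
by apply: (mulIf c0); rewrite -[in LHS]fc -rmorphM /= ac fb.
Qed.

End FractionFieldPeriod.

(** * Eventual periodicity and the Mathieu-Zhao property *)

Theorem theorem2p4 (k : closedFieldType) (k_char0 : [pchar k] =i pred0)
    (A : idomainAlgType k) (A_local : local_ring A)
    (phi : {lrmorphism A -> A}) (phi_lf : locally_finite phi)
    (fin_gen : fin_gen_algebra A \/
       (injective phi /\ fin_gen_field_ext (fraction_emb A))) :
  (exists i j : nat,
     [/\ (1 <= i)%N, (i < j)%N & forall a : A, iter i phi a = iter j phi a])
  /\ MZ_space (range (fun a : A => a - phi a)).
Proof.
have [e [N [N_gt0 per]]] : exists e N, (0 < N)%N /\ forall a, iter (e + N) phi a = iter e phi a.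
  case: fin_gen => [[s sT]|[phi_inj [s sT]]].
    have [e [N [N_gt0 per]]] := common_period k_char0 A_local phi_lf s.
    by exists e, N; split=> //; apply: (fin_gen_algebra_ext sT per).
  have [f fE] := choice (@fractionP A); have [g gE] := choice fE.
  have [e [N [N_gt0 per]]] := common_period k_char0 A_local phi_lf (map f s ++ map g s).
  exists 0%N, N; split=> // a.
  have iter_inj : injective (iter e phi) by elim: (e) => //= m IHm x y /phi_inj/IHm.
  have fixN b : b \in map f s ++ map g s -> iter N phi b = b.
    by move=> /per; rewrite iterD => /iter_inj.
  apply: (fixed_fractions_id sT) => q qs; have [g0 qE] := gE q.
  by exists (f q), (g q); split=> //; apply: fixN; rewrite mem_cat map_f ?orbT.
split; last exact: image_1B_MZ k_char0 N_gt0 per.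
exists e.+1, (e.+1 + N)%N; split=> //; first by rewrite -[X in (X < _)%N]addn0 ltn_add2l.
by move=> a; rewrite addSn !iterS per.
Qed.
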